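(* Let $R$ be a commutative ring, let $q$ be an indeterminate, and let $S$ be the antipode of $\mathtt{QSym}^{(q)}$. Then for every $n\geq0$ and every composition $\alpha\vDash n$ we have $$S(M_{\alpha}^{(q)})=(-1)^{\ell(\alpha)}E_{\alpha^{r}}^{(q)}.$$
   Context: Compositions. A composition $\alpha\vDash n$ of an integer $n\geq0$ is a finite sequence $(\alpha_{1},\ldots,\alpha_{\ell})$ of positive integers summing to $n$; $\ell(\alpha)=\ell$ is its length, and $\emptyset$ is the only composition of $0$. For compositions $\alpha,\beta$ of the same $n$, $\beta\preceq\alpha$ (equivalently $\alpha\succeq\beta$) means that $\beta$ refines $\alpha$, i.e., $\beta$ is the concatenation, in order, of compositions of $\alpha_{1},\ldots,\alpha_{\ell}$. The reversal $\alpha^{r}$ is $\alpha$ written in the opposite order. The inversion number is $\operatorname{inv}(\alpha)=\sum_{1\leq i<j\leq\ell}\alpha_{i}\alpha_{j}$. The algebra $\mathtt{QSym}^{(q)}$. Consider power series over $R[q]$ in variables $x_{1},x_{2},\ldots$ subject to $x_{j}x_{i}=qx_{i}x_{j}$ for $i<j$. For a composition $\alpha$ of length $\ell$ set $M_{\alpha}^{(q)}=\sum_{i_{1}<\cdots<i_{\ell}}x_{i_{1}}^{\alpha_{1}}\cdots x_{i_{\ell}}^{\alpha_{\ell}}$. Then $\mathtt{QSym}^{(q)}$ is the free $R[q]$-module with basis $\{M_{\alpha}^{(q)}\}_{\alpha}$, $\alpha$ running over all compositions. It is closed under the product: $M_{\emptyset}^{(q)}=1$, and for $\alpha=(\alpha_{1},\bar{\alpha})$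 with $\bar{\alpha}\vDash m$ and $\beta=(\beta_{1},\bar{\beta})$, $$M_{\alpha}^{(q)}M_{\beta}^{(q)}=l_{\alpha_{1}}(M_{\bar{\alpha}}^{(q)}M_{\beta}^{(q)})+q^{\beta_{1}(\alpha_{1}+m)}l_{\beta_{1}}(M_{\alpha}^{(q)}M_{\bar{\beta}}^{(q)})+q^{\beta_{1}m}l_{\alpha_{1}+\beta_{1}}(M_{\bar{\alpha}}^{(q)}M_{\bar{\beta}}^{(q)}),$$ where $l_{a}$ is the $R[q]$-linear map with $l_{a}M_{\gamma}^{(q)}=M_{(a,\gamma)}^{(q)}$. The co-multiplication is $\Delta(M_{\alpha}^{(q)})=\sum_{k=0}^{\ell(\alpha)}M_{(\alpha_{1},\ldots,\alpha_{k})}^{(q)}\otimes M_{(\alpha_{k+1},\ldots,\alpha_{\ell(\alpha)})}^{(q)}$ (tensor over $R[q]$), and the co-unit $\varepsilon$ sends $M_{\emptyset}^{(q)}$ to $1$ and the other $M_{\alpha}^{(q)}$ to $0$. With $m$ the multiplication and $\eta$ the unit, this is an algebra and a co-algebra (a ''$q$-Hopf algebra'', not a Hopf algebra, since $\Delta$ is not multiplicative), and its antipode is the unique $R[q]$-linear map $S$ with $m\circ(S\otimes\operatorname{Id})\circ\Delta=\eta\circ\varepsilon=m\circ(\operatorname{Id}\otimes S)\circ\Delta$, which exists. Set $E_{\alpha}^{(q)}=\sum_{\beta\succeq\alpha}q^{\operatorname{inv}(\beta)}M_{\beta}^{(q)}$. *)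

(* Defs.v *)
From HB Require Import structures.
From mathcomp Require Import all_boot all_order all_algebra.
From mathcomp Require Import ring.
From mathcomp Require Import finmap.
From mathcomp Require Import monalg.

Set Implicit Arguments.
Unset Strict Implicit.
Unset Printing Implicit Defensive.

Import GRing.Theory.
Local Open Scope ring_scope.

Notation posnat := {k : nat | (0 < k)%N}.

Definition pos1 : posnat := Sub 1%N isT.
Definition addp (a b : posnat) : posnat :=
  Sub (val a + val b)%N (ltn_addr (val b) (valP a)).

Notation composition := (seq posnat).

Definition parts (a : composition) : seq nat := [seq val i | i <- a].

Definition weight (a : composition) : nat := sumn (parts a).

Definition is_composition_of (n : nat) (a : composition) : bool :=
  weight a == n.

(* [refines b a] : b is a concatenation, in order, of compositions of the
   parts of a; see [refinesP]. *)
Fixpoint refines (b a : composition) : bool :=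
  match a with
  | [::] => b == [::]
  | x :: a' =>
      [exists k : 'I_(size b).+1,
         is_composition_of (val x) (take k b) && refines (drop k b) a']
  end.

Definition inv (a : composition) : nat :=
  (\sum_(i < size a) \sum_(j < size a | i < j)
     nth 0 (parts a) i * nth 0 (parts a) j)%N.

(* A composition of n+1 starts with the part 1, followed by a composition of
   n, or arises from a nonempty composition of n by increasing its first part.
   See [mem_compositions] and [compositions_uniq]. *)
Fixpoint compositions (n : nat) : seq composition :=
  match n with
  | 0 => [:: [::]]
  | m.+1 =>
      [seq pos1 :: c | c <- compositions m] ++
      [seq if c is a :: c' then addp a pos1 :: c' else c
         | c <- compositions m & c != [::]]
  end.

Lemma refinesP (b a : composition) :
  reflect (exists2 bs : seq composition,
             b = flatten bs & [seq weight c | c <- bs] = parts a)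
          (refines b a).
Proof.
elim: a b => [|x a IHa] b /=.
  by apply: (iffP eqP) => [->|[[|c bs] -> //]]; exists [::].
apply: (iffP existsP) => [[k /andP[/eqP wk /IHa[bs db wbs]]]|[[|c bs] //= ->]].
  by exists (take k b :: bs); rewrite /= -?db ?cat_take_drop // wk wbs.
case=> wc wbs; have lt_c : (size c < (size (c ++ flatten bs)).+1)%N.
  by rewrite ltnS size_cat leq_addr.
exists (Ordinal lt_c); rewrite /= take_size_cat // drop_size_cat //.
by rewrite /is_composition_of wc eqxx; apply/IHa; exists bs.
Qed.

Lemma mem_compositions (n : nat) (c : composition) :
  (c \in compositions n) = is_composition_of n c.
Proof.
have wS d : (0 < size d)%N -> (0 < weight d)%N.
  by case: d => [//|[x hx] d] _; rewrite /weight /= ltn_addr.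
elim: n c => [|n IHn] c /=.
  rewrite inE /is_composition_of; apply/eqP/eqP => [-> //|w0].
  by case: c w0 (wS c) => [//|x c] -> /= /(_ isT).
rewrite mem_cat; apply/orP/eqP => [[/mapP[d]|/mapP[d]]|].
- by rewrite IHn => /eqP wd ->; rewrite /weight /= -/(weight d) wd.
- rewrite mem_filter IHn => /andP[] + /eqP wd ->.
  by case: d wd => [//|x d]; rewrite /weight /= => <- _; rewrite addn1 addSn.
case: c => [//|[[//|[|k]] hk] c]; rewrite /weight /=.
  rewrite add1n => -[wc]; left; apply/mapP; exists c; last first.
    by congr (_ :: _); apply: val_inj.
  by rewrite IHn; apply/eqP.
rewrite addSn => -[wc]; right; apply/mapP.
exists ((Sub k.+1 isT : posnat) :: c).
  by rewrite mem_filter IHn; apply/andP; split=> //; apply/eqP.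
by congr (_ :: _); apply: val_inj; rewrite /= addn1.
Qed.

Lemma compositions_uniq (n : nat) : uniq (compositions n).
Proof.
have addp1_inj : injective (addp^~ pos1).
  by move=> a b /(congr1 val) /= /eqP; rewrite eqn_add2r => /eqP/val_inj.
have addp1_neq a : pos1 <> addp a pos1.
  by move=> /(congr1 val) /=; case: a => -[|k] //= _; rewrite addn1.
elim: n => [//|n IHn] /=; rewrite cat_uniq; apply/and3P; split.
- by rewrite map_inj_uniq // => x y [].
- apply/hasPn => d /mapP[[|a c]]; rewrite mem_filter //= => _ ->.
  by apply/negP => /mapP[e _ /(congr1 (head pos1))] /= /esym; apply: addp1_neq.
- rewrite map_inj_in_uniq ?filter_uniq // => -[|a c] [|b d];
    rewrite ?mem_filter //= => _ _ eq_cd.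
  have /= /addp1_inj-> := congr1 (head pos1) eq_cd.
  by have /= -> := congr1 behead eq_cd.
Qed.

Section FreeModule.
Variables (A : nzRingType) (K : choiceType) (V : lmodType A).

Definition lext (f : K -> V) (x : {malg A[K]}) : V :=
  \sum_(k <- msupp x) x@_k *: f k.

Lemma lextE (f : K -> V) (d : {fset K}) (x : {malg A[K]}) :
  (msupp x `<=` d)%fset -> lext f x = \sum_(k <- d) x@_k *: f k.
Proof.
move=> le_d; rewrite /lext (big_fset_incl _ le_d) // => k _ /mcoeff_outdom ->.
by rewrite scale0r.
Qed.

Lemma lext_is_linear (f : K -> V) : linear (lext f).
Proof.
move=> c x y.
set d := (msupp x `|` msupp y `|` msupp (c *: x + y))%fset.
have dx : (msupp x `<=` d)%fset by rewrite /d -fsetUA fsubsetUl.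
have dy : (msupp y `<=` d)%fset by rewrite /d fsetUAC fsubsetUr.
rewrite (lextE f dx) (lextE f dy) (lextE f (fsubsetUr _ _) : _ = \sum_(k <- d) _).
rewrite scaler_sumr -big_split; apply: eq_bigr => k _ /=.
by rewrite mcoeffD mcoeffZ scalerDl scalerA.
Qed.

HB.instance Definition _ (f : K -> V) :=
  GRing.isLinear.Build A {malg A[K]} V _ (lext f) (lext_is_linear f).

Lemma lextU (f : K -> V) (k : K) : lext f << k >> = f k.
Proof. by rewrite (lextE _ msuppU_le) big_seq_fset1 mcoeffUU scale1r. Qed.

End FreeModule.

(* The free R[q]-module on all compositions, with q the indeterminate 'X. *)
Notation QSym R := {malg {poly R}[composition]}.

(* The tensor square over R[q] is free on the pairs of compositions, the pair
   (a, b) standing for the tensor product of M a and M b. *)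
Notation QSym2 R := {malg {poly R}[(composition * composition)%type]}.

Section QSym.
Variable R : comNzRingType.

Definition M (a : composition) : QSym R := << a >>.

Definition tens (x y : QSym R) : QSym2 R :=
  lext (fun a => lext (fun b => << (a, b) >> : QSym2 R) y) x.

Definition tensmap (f g : QSym R -> QSym R) : QSym2 R -> QSym2 R :=
  lext (fun p => tens (f (M p.1)) (g (M p.2))).

Definition lcons (a : posnat) : QSym R -> QSym R := lext (fun c => M (a :: c)).

(* Computes the product of the q-power series M a and M b: see [realize_mulM]
   and [realize_qmul]. *)
Fixpoint mulM (a : composition) : composition -> QSym R :=
  match a with
  | [::] => fun b => M b
  | a1 :: a' =>
      fix mulMa (b : composition) : QSym R :=
        match b with
        | [::] => M a
        | b1 :: b' =>
            lcons a1 (mulM a' b)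
            + 'X^(val b1 * (val a1 + weight a')) *: lcons b1 (mulMa b')
            + 'X^(val b1 * weight a') *: lcons (addp a1 b1) (mulM a' b')
        end
  end.

Definition qmul : QSym2 R -> QSym R := lext (fun p => mulM p.1 p.2).

Definition qunit (c : {poly R}) : QSym R := c *: M [::].

Definition qcomul : QSym R -> QSym2 R :=
  lext (fun a => \sum_(k < (size a).+1) tens (M (take k a)) (M (drop k a))).

Definition qcounit : QSym R -> {poly R}^o :=
  lext (fun a => (a == [::])%:R : {poly R}^o).

Definition is_antipode (S : {linear QSym R -> QSym R}) : Prop :=
  (forall x, qmul (tensmap S id (qcomul x)) = qunit (qcounit x)) /\
  (forall x, qunit (qcounit x) = qmul (tensmap id S (qcomul x))).

Definition E (a : composition) : QSym R :=
  \sum_(b <- compositions (weight a) | refines a b) 'X^(inv b) *: M b.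

(* A power series in x_1, x_2, ... subject to x_j x_i = q x_i x_j for i < j is
   given by its coefficients at the monomials x_1^e_1 ... x_N^e_N, indexed by
   the exponent sequences e (for all N; appending zeros to e does not change
   the monomial). *)

Definition qseries : Type := seq nat -> {poly R}.

(* The pairs (d, e) of exponent sequences with d + e = s, termwise. *)
Fixpoint splits (s : seq nat) : seq (seq nat * seq nat) :=
  match s with
  | [::] => [:: ([::], [::])]
  | i :: s' =>
      [seq (j :: p.1, (i - j)%N :: p.2) | j <- iota 0 i.+1, p <- splits s']
  end.

(* x^d x^e = q^(qexp d e) x^(d+e), where qexp d e is the sum of e_i d_j over
   i < j. *)
Fixpoint qexp (d e : seq nat) : nat :=
  match d, e with
  | _ :: d', i :: e' => (i * sumn d' + qexp d' e')%N
  | _, _ => 0%N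
  end.

Definition qseries_mul (f g : qseries) : qseries := fun s =>
  \sum_(p <- splits s) 'X^(qexp p.1 p.2) * f p.1 * g p.2.

(* The sum of x_(i_1)^a_1 ... x_(i_l)^a_l over i_1 < ... < i_l: all the
   monomials whose sequence of nonzero exponents is a, with coefficient 1. *)
Definition Mseries (a : composition) : qseries := fun s =>
  ([seq i <- s | (0 < i)%N] == parts a)%:R.

Definition realize (x : QSym R) : qseries := fun s =>
  lext (fun a => Mseries a s : {poly R}^o) x.

Lemma realize_M a s : realize (M a) s = Mseries a s.
Proof. by rewrite /realize /M lextU. Qed.

Lemma realize_inj (x y : QSym R) : realize x =1 realize y -> x = y.
Proof.
move=> eqxy; apply/malgP => a.
suff rE z : realize z (parts a) = z@_a by rewrite -!rE eqxy.
rewrite [in RHS](monalgE z) raddf_sum /=; apply: eq_bigr => c _.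
rewrite mcoeffU /Mseries; have -> : [seq i <- parts a | (0 < i)%N] = parts a.
  by apply/all_filterP/allP => i /mapP[j _ ->]; apply: valP.
rewrite (inj_eq (inj_map val_inj)) eq_sym.
by case: eqP => _; rewrite /GRing.scale /= ?mulr1 ?mulr0.
Qed.

Lemma Mseries0 a s : Mseries a (0%N :: s) = Mseries a s.
Proof. by []. Qed.

Lemma MseriesS a i s : Mseries a (i.+1 :: s) =
  if a is b :: a' then (i.+1 == val b)%:R * Mseries a' s else 0.
Proof.
by rewrite /Mseries; case: a => [|b a] //=; rewrite eqseq_cons -natrM mulnb.
Qed.

Lemma Mseries_wt a s (f : nat -> {poly R}) :
  f (sumn s) * Mseries a s = f (weight a) * Mseries a s.
Proof.
rewrite /Mseries; case: eqP => [eqs|_]; last by rewrite !mulr0.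
rewrite /weight -eqs; congr (f _ * _).
by elim: s {eqs} => //= -[|i] s -> .
Qed.

Lemma realize_lconsE b x t :
  realize (lcons b x) t = \sum_(a <- msupp x) x@_a * Mseries (b :: a) t.
Proof.
rewrite /realize /lcons {2}/lext raddf_sum /=; apply: eq_bigr => a _.
by rewrite linearZ /= lextU.
Qed.

Lemma realize_lcons_nil b x : realize (lcons b x) [::] = 0.
Proof. by rewrite realize_lconsE big1 // => a _; rewrite /Mseries mulr0. Qed.

Lemma realize_lcons0 b x s : realize (lcons b x) (0%N :: s) = realize (lcons b x) s.
Proof. by rewrite !realize_lconsE. Qed.

Lemma realize_lconsS b x i s :
  realize (lcons b x) (i.+1 :: s) = (i.+1 == val b)%:R * realize x s.
Proof.
rewrite realize_lconsE /realize /lext mulr_sumr.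
by apply: eq_bigr => a _; rewrite MseriesS mulrCA.
Qed.

Lemma realizeD x y s : realize (x + y) s = realize x s + realize y s.
Proof. by rewrite /realize linearD. Qed.

Lemma realizeZ c x s : realize (c *: x) s = c * realize x s.
Proof. by rewrite /realize linearZ. Qed.

Lemma realize3 c d x y z s u v w :
    realize x s = u -> realize y s = v -> realize z s = w ->
  realize (x + c *: y + d *: z) s = u + c * v + d * w.
Proof. by move=> <- <- <-; rewrite 2!realizeD 2!realizeZ. Qed.

Lemma mul_cons (f g : qseries) i s : qseries_mul f g (i :: s) =
  \sum_(j < i.+1) qseries_mul
     (fun d => 'X^((i - j) * sumn d) * f (val j :: d)) (fun e => g ((i - j)%N :: e)) s.
Proof.
rewrite /qseries_mul big_allpairs_dep /= -/(index_iota 0 i.+1).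
rewrite -/(iota 0 i.+1) -[iota 0 i.+1]/(index_iota 0 i.+1) big_mkord.
apply: eq_bigr => j _; apply: eq_bigr => p _ /=.
by rewrite exprD -!mulrA mulrCA.
Qed.

Lemma mul_ext c k f g f' g' s :
    (forall d, f d = c * f' d) -> (forall e, g e = k * g' e) ->
  qseries_mul f g s = c * k * qseries_mul f' g' s.
Proof.
move=> ef eg; rewrite /qseries_mul mulr_sumr; apply: eq_bigr => p _.
by rewrite ef eg; ring.
Qed.

Local Definition MM a b s := qseries_mul (Mseries a) (Mseries b) s.

Lemma MM_0 a b s : MM a b (0%N :: s) = MM a b s.
Proof.
rewrite /MM mul_cons big_ord1 (@mul_ext 1 1 _ _ (Mseries a) (Mseries b)) //=.
- by rewrite !mul1r.
- by move=> d; rewrite mul1r.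
Qed.

Lemma MM_S a b i s : MM a b (i.+1 :: s) =
  (if b is b1 :: b' then (i.+1 == val b1)%:R * 'X^(i.+1 * weight a) * MM a b' s
   else 0)
  + (if a is a1 :: a' then (i.+1 == val a1)%:R * MM a' b s else 0)
  + (if a is a1 :: a' then if b is b1 :: b' then
       (i.+1 == val a1 + val b1)%:R * 'X^(val b1 * weight a') * MM a' b' s
     else 0 else 0).
Proof.
rewrite /MM mul_cons big_ord_recl big_ord_recr /= [X in _ + X]addrC addrA.
have zl f g t : (forall d, f d = 0) -> qseries_mul f g t = 0.
  by move=> f0; rewrite /qseries_mul big1 // => p _; rewrite f0 mulr0 mul0r.
have zr f g t : (forall d, g d = 0) -> qseries_mul f g t = 0.
  by move=> g0; rewrite /qseries_mul big1 // => p _; rewrite g0 mulr0.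
congr (_ + _ + _).
- case: b => [|b1 b]; first by apply: zr => d; rewrite subn0 MseriesS.
  rewrite (@mul_ext 'X^(i.+1 * weight a) (i.+1 == val b1)%:R _ _
             (Mseries a) (Mseries b)) ?[_ * _%:R]mulrC //.
    by move=> d; rewrite subn0 (Mseries_wt _ _ (fun n => 'X^(i.+1 * n))).
  by move=> e; rewrite subn0 MseriesS.
- rewrite /bump /= add1n; case: a => [|a1 a].
    by apply: zl => d; rewrite MseriesS mulr0.
  rewrite (@mul_ext (i.+1 == val a1)%:R 1 _ _ (Mseries a) (Mseries b)) ?mulr1 //.
    by move=> d; rewrite subnn mul0n expr0 mul1r MseriesS.
  by move=> e; rewrite subnn mul1r.
- case: a => [|a1 a].
    by rewrite big1 // => j _; apply: zl => d; rewrite MseriesS mulr0.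
  have sS (j : 'I_i) : (i.+1 - (bump 0 j) = (i - j.+1).+1)%N.
    by rewrite /bump add1n subSS -subSn // subSS.
  case: b => [|b1 b].
    by rewrite big1 // => j _; apply: zr => e; rewrite sS MseriesS.
  transitivity (\sum_(j < i) (((bump 0 j == val a1) && (i.+1 - bump 0 j == val b1)%N)%:R
      * 'X^(val b1 * weight a)) * qseries_mul (Mseries a) (Mseries b) s).
    apply: eq_bigr => j _.
    rewrite (@mul_ext ((bump 0 j == val a1)%:R * 'X^((i.+1 - bump 0 j) * weight a))
      (i.+1 - bump 0 j == val b1)%N%:R _ _ (Mseries a) (Mseries b)).
    - rewrite -mulnb natrM; have [->|_] := eqVneq (i.+1 - bump 0 j)%N (val b1).
        by rewrite !mulr1.
      by rewrite !mulr0 !mul0r.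
    - move=> d; rewrite MseriesS mulrCA.
      by rewrite (Mseries_wt _ _ (fun n => 'X^((i.+1 - bump 0 j) * n))) mulrA.
    - by move=> e; rewrite sS MseriesS.
  rewrite -mulr_suml; congr (_ * _); rewrite -mulr_suml; congr (_ * _).
  have [a_gt0 b_gt0] := (valP a1, valP b1).
  have [eqi|neqi] := eqVneq i.+1 (val a1 + val b1)%N.
    have lt_a : ((val a1).-1 < i)%N.
      by rewrite -ltnS prednK // eqi -addn1 leq_add2l.
    rewrite (bigD1 (Ordinal lt_a)) //= big1 => [|j neqj].
      by rewrite /bump add1n prednK // eqi addKn !eqxx addr0.
    case: eqP => // eqj; case/eqP: neqj; apply: val_inj => /=.
    by rewrite -eqj /bump add1n.
  rewrite big1 // => j _; case: andP => // -[/eqP eqa /eqP eqb].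
  case/eqP: neqi; rewrite -eqa -eqb subnKC // /bump add1n.
  exact: leqW (ltn_ord j).
Qed.

Lemma mulM_nil b : mulM [::] b = M b.
Proof. by []. Qed.

Lemma mulM_cons_nil a1 a : mulM (a1 :: a) [::] = M (a1 :: a).
Proof. by []. Qed.

Lemma mulM_cons a1 a b1 b : mulM (a1 :: a) (b1 :: b) =
  lcons a1 (mulM a (b1 :: b))
  + 'X^(val b1 * (val a1 + weight a)) *: lcons b1 (mulM (a1 :: a) b)
  + 'X^(val b1 * weight a) *: lcons (addp a1 b1) (mulM a b).
Proof. by []. Qed.

Lemma realize_mulM a b s :
  realize (mulM a b) s = qseries_mul (Mseries a) (Mseries b) s.
Proof.
rewrite -/(MM a b s); elim: s a b => [|[|i] s IHs] a b.
- have -> : MM a b [::] = (a == [::])%:R * (b == [::])%:R.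
    rewrite /MM /qseries_mul big_seq1 expr0 mul1r.
    by case: a b => [|a1 a] [|b1 b].
  case: a b => [|a1 a] [|b1 b].
  + by rewrite mulM_nil realize_M mul1r.
  + by rewrite mulM_nil realize_M mul1r.
  + by rewrite mulM_cons_nil realize_M mul0r.
  + rewrite mulM_cons.
    rewrite (realize3 _ _ (realize_lcons_nil _ _) (realize_lcons_nil _ _)
                          (realize_lcons_nil _ _)).
    by rewrite !mulr0 !addr0.
- rewrite MM_0 -IHs; case: a b => [|a1 a] [|b1 b].
  + by rewrite mulM_nil !realize_M.
  + by rewrite mulM_nil !realize_M.
  + by rewrite mulM_cons_nil !realize_M.
  + rewrite mulM_cons.
    rewrite (realize3 _ _ (realize_lcons0 _ _ _) (realize_lcons0 _ _ _)
                          (realize_lcons0 _ _ _)).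
    by apply: esym; apply: realize3.
- rewrite MM_S; case: a b => [|a1 a] [|b1 b].
  + by rewrite mulM_nil realize_M MseriesS !addr0.
  + have -> : weight [::] = 0%N by [].
    by rewrite mulM_nil realize_M MseriesS muln0 expr0 mulr1 -IHs mulM_nil
               realize_M !addr0.
  + rewrite mulM_cons_nil realize_M MseriesS -IHs add0r addr0.
    by case: a => [|a2 a]; rewrite ?mulM_nil ?mulM_cons_nil realize_M.
  + rewrite mulM_cons.
    rewrite (realize3 _ _ (realize_lconsS _ _ _ _) (realize_lconsS _ _ _ _)
                          (realize_lconsS _ _ _ _)) 3!IHs.
    have -> : val (addp a1 b1) = (val a1 + val b1)%N by [].
    have -> : weight (a1 :: a) = (val a1 + weight a)%N by [].
    rewrite [X in X + _]addrC; congr (_ + _ + _); rewrite mulrA.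
      by have [->|_] := eqVneq i.+1 (val b1); rewrite ?mul1r ?mulr1 // !(mulr0, mul0r).
    by rewrite ['X^_ * _%:R]mulrC.
Qed.

Lemma realize_qmul x y s :
  realize (qmul (tens x y)) s = qseries_mul (realize x) (realize y) s.
Proof.
have qE : qmul (tens x y) =
    \sum_(a <- msupp x) \sum_(b <- msupp y) x@_a *: (y@_b *: mulM a b).
  rewrite /tens {1}/lext /qmul raddf_sum; apply: eq_bigr => a _ /=.
  rewrite linearZ /= -scaler_sumr; congr (_ *: _).
  rewrite [X in lext _ X]/lext raddf_sum; apply: eq_bigr => b _ /=.
  by rewrite linearZ /= lextU.
have rE z d : realize z d = \sum_(a <- msupp z) z@_a * Mseries a d by [].
have rS (I : choiceType) (r : {fset I}) (F : I -> QSym R) :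
    realize (\sum_(k <- r) F k) s = \sum_(k <- r) realize (F k) s.
  by rewrite /realize raddf_sum.
rewrite qE rS; under eq_bigr => a _ do rewrite rS.
under eq_bigr => a _ do under eq_bigr => b _ do
  rewrite !realizeZ realize_mulM /qseries_mul !mulr_sumr.
under eq_bigr => a _ do rewrite exchange_big.
rewrite exchange_big; apply: eq_bigr => p _ /=.
rewrite !rE -mulrA big_distrlr mulr_sumr; apply: eq_bigr => a _ /=.
by rewrite mulr_sumr; apply: eq_bigr => b _; ring.
Qed.

End QSym.

(* Main.v *)
(** For a composition [a], the [k]-th summand of [m o (S (x) Id) o Delta] at
    [M a] is, up to sign, [E_(rev (take k a)) * M_(drop k a)].  The first part
    of each monomial of this product is the sum of a block of consecutive parts
    of [a], and this block ends either at the [k]-th part of [a] or at the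
    [k+1]-st.  The sum of the terms whose block ends at the [k]-th part turns
    out to be the same, powers of [q] included, whether it is read off the
    [k]-th or the [k-1]-st product, so that the alternating sum telescopes.
    Thus [(-1)^(l(a)) E_(rev a)] solves the recursion that determines
    [S (M a)]. *)

Require Import Defs.
From HB Require Import structures.
From mathcomp Require Import all_boot all_order all_algebra.
From mathcomp Require Import finmap monalg.
Import GRing.Theory.
Local Open Scope ring_scope.

(** * Weights, inversion numbers and first blocks of a refinement *)

Lemma weight_cons (x : posnat) (a : composition) :
  weight (x :: a) = (val x + weight a)%N.
Proof. by []. Qed.

Lemma weight_cat (a b : composition) : weight (a ++ b) = (weight a + weight b)%N.
Proof. by rewrite /weight /parts map_cat sumn_cat. Qed.

Lemma inv_cons (x : posnat) (a : composition) :
  Defs.inv (x :: a) = (val x * weight a + Defs.inv a)%N.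
Proof.
rewrite /Defs.inv /= big_ord_recl /=; congr (_ + _)%N.
  rewrite big_mkcond big_ord_recl /= add0n -big_distrr /=; congr (_ * _)%N.
  rewrite /weight sumnE (big_nth 0%N) size_map big_mkord.
  by apply: eq_bigr.
apply: eq_bigr => i _; rewrite big_mkcond big_ord_recl /= add0n [RHS]big_mkcond.
by apply: eq_bigr => j _.
Qed.

Lemma refines_weight (b a : composition) : refines b a -> weight b = weight a.
Proof.
move=> /refinesP[bs -> wbs]; rewrite [RHS]/weight -wbs.
by elim: bs {wbs} => //= c bs IHbs; rewrite weight_cat IHbs.
Qed.

(** Parts are positive, so weights of prefixes increase strictly; hence a first block is determined
    by its sum. *)
Lemma weight_take_inj (a : composition) (i j : nat) :
  (i <= size a)%N -> (j <= size a)%N ->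
  weight (take i a) = weight (take j a) -> i = j.
Proof.
elim: a i j => [|x a IHa] [|i] [|j] //= lei lej.
- by rewrite weight_cons => e; have := valP x; case: (val x) e.
- by rewrite weight_cons => e; have := valP x; case: (val x) e.
by rewrite !weight_cons => /addnI/IHa ->.
Qed.

(** Keeping [x] apart from [c] makes the sum positive even for empty [c]. *)
Definition block (x : posnat) (c : composition) : posnat :=
  Sub (val x + weight c)%N (ltn_addr (weight c) (valP x)).

Lemma block_nil (x : posnat) : block x [::] = x.
Proof. by apply: val_inj; rewrite /= addn0. Qed.

Lemma val_block_drop (x : posnat) (c : composition) (i : nat) :
  (val x + weight (take i c) + weight (drop i c))%N = weight (x :: c).
Proof. by rewrite weight_cons -[in RHS](cat_take_drop i c) weight_cat addnA. Qed.

Lemma addp_block (x y : posnat) (c : composition) :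
  addp (block x c) y = block y (x :: c).
Proof. by apply: val_inj; rewrite /= weight_cons addnC. Qed.

Lemma refines_consP (a : composition) (x y : posnat) (b : composition) :
  reflect (exists2 i : 'I_(size a).+1,
             block x (take i a) = y & refines (drop i a) b)
          (refines (x :: a) (y :: b)).
Proof.
apply: (iffP existsP) => [[[[|k] ltk] /= /andP[/eqP wk refb]]|[[i lti] /= <- refb]].
- by have := valP y; rewrite /= -wk.
- by exists (Ordinal (ltk : (k < (size a).+1)%N)); first apply: val_inj.
have lti' : (i.+1 < (size (x :: a)).+1)%N by [].
by exists (Ordinal lti'); apply/andP; split; first exact: eqxx.
Qed.

Section QSym.
Variable R : comNzRingType.
Implicit Types (a b c d : composition) (x y : posnat) (u v : QSym R).

(** * Coefficients of [lcons] and [E], and a recursion for [E] *)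

Lemma mcoeff_lcons_nil x u : (lcons x u)@_[::] = 0.
Proof.
rewrite /lcons /lext raddf_sum big1 //= => k _.
by rewrite /M mcoeffZ mcoeffU mulr0.
Qed.

Lemma mcoeff_lcons x u y b : (lcons x u)@_(y :: b) = (x == y)%:R * u@_b.
Proof.
rewrite [in RHS](monalgE u) /lcons /lext !raddf_sum mulr_sumr.
apply: eq_bigr => k _ /=; rewrite /M mcoeffZ !mcoeffU eqseq_cons.
by rewrite -mulnb natrM -[_ *+ (k == b)]mulr_natr mulrCA.
Qed.

Lemma mcoeff_E a b :
  (E R a)@_b = if refines a b then 'X^(Defs.inv b) else 0.
Proof.
rewrite /E big_mkcond raddf_sum /=.
have cE c : (if refines a c then 'X^(Defs.inv c) *: M R c else 0)@_b =
    if c == b then if refines a b then 'X^(Defs.inv b) else 0 else 0.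
  case: ifP => [ref_ac|]; last by case: eqP => [<- ->|_ _]; rewrite mcoeff0.
  rewrite /M mcoeffZ mcoeffU; case: eqP => [<-|_]; last by rewrite mulr0.
  by rewrite ref_ac mulr1.
under eq_bigr do rewrite cE.
rewrite -big_mkcond; case: ifP => [ref_ab|]; last by rewrite big1_eq.
rewrite -big_filter filter_pred1_uniq ?compositions_uniq ?big_seq1 //.
by rewrite mem_compositions /is_composition_of (refines_weight _ _ ref_ab).
Qed.

Lemma E_nil : E R [::] = M R [::].
Proof.
apply/malgP => b; rewrite mcoeff_E /M mcoeffU.
have [<-|] := eqVneq [::] b.
  by rewrite /Defs.inv big_ord0 expr0.
case: b => // y b _; case: ifP => // /refines_weight /esym.
by rewrite weight_cons; have := valP y; case: (val y).
Qed.

(** Coarsenings of [x :: c] are sorted by their first part, a block starting at [x]. By [inv_cons],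
    splitting it off costs [q] to the power block times remaining weight. *)
Lemma E_cons x c :
  E R (x :: c) =
  \sum_(i < (size c).+1)
     'X^(val (block x (take i c)) * weight (drop i c))
       *: lcons (block x (take i c)) (E R (drop i c)).
Proof.
apply/malgP => -[|y b]; rewrite [RHS]raddf_sum.
  by rewrite mcoeff_E big1 // => i _; rewrite /= mcoeffZ mcoeff_lcons_nil mulr0.
under eq_bigr => i _ do rewrite /= mcoeffZ mcoeff_lcons mcoeff_E.
rewrite mcoeff_E; case: (refines_consP c x y b) => [[i yE ref_i]|nref].
  rewrite (bigD1 i) //= yE eqxx ref_i mul1r -yE inv_cons.
  (* All other indices give a first part different from [y]. *)
  rewrite (refines_weight _ _ ref_i) exprD big1 ?addr0 // => j neq_ji.
  case: eqP => [yE'|]; last by rewrite mul0r mulr0.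
  case/eqP: neq_ji; apply: val_inj; apply: (weight_take_inj c).
  - exact: (ltn_ord j).
  - exact: (ltn_ord i).
  - by have /(congr1 val)/addnI := yE'.
rewrite big1 // => i _; case: eqP => [yE|]; last by rewrite mul0r mulr0.
case: ifP => [ref_i|]; last by rewrite !mulr0.
by case: nref; exists i.
Qed.

(** * Right multiplication by [M b], and the telescoping sums *)

Definition rmul b : QSym R -> QSym R := lext (fun a => mulM R a b).

HB.instance Definition _ b := GRing.Linear.on (rmul b).
HB.instance Definition _ x := GRing.Linear.on (@lcons R x).
HB.instance Definition _ := GRing.Linear.on (@qmul R).
HB.instance Definition _ f g := GRing.Linear.on (@tensmap R f g).

Lemma qmul_tensM u b : qmul (tens u (M R b)) = rmul b u.
Proof.
rewrite /tens {1}/lext raddf_sum; apply: eq_bigr => a _ /=.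
by rewrite linearZ /= /M lextU /qmul lextU.
Qed.

Lemma rmul_nil u : rmul [::] u = u.
Proof.
rewrite [RHS]monalgE /rmul /lext; apply: eq_bigr => a _.
have -> : mulM R a [::] = M R a by case: a.
by apply/malgP => k; rewrite /M mcoeffZ !mcoeffU mulr_natr.
Qed.

Lemma rmul_M a b : rmul b (M R a) = mulM R a b.
Proof. exact: lextU. Qed.

Lemma lcons_M x a : lcons x (M R a) = M R (x :: a).
Proof. exact: lextU. Qed.

(** The exponents in [mulM_cons] depend on the left factor only through its weight, so for
    homogeneous [u] the recursion extends linearly. *)
Lemma rmul_lcons x u y b (m : nat) :
    (forall k, k \in msupp u -> weight k = m) ->
  rmul (y :: b) (lcons x u) =
    lcons x (rmul (y :: b) u)
    + 'X^(val y * (val x + m)) *: lcons y (rmul b (lcons x u))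
    + 'X^(val y * m) *: lcons (addp x y) (rmul b u).
Proof.
move=> wu; have lE : lcons x u = \sum_(k <- msupp u) u@_k *: M R (x :: k) by [].
have rE d : rmul d u = \sum_(k <- msupp u) u@_k *: mulM R k d by [].
rewrite lE !rE !(raddf_sum (rmul _)) !(raddf_sum (lcons _)) !scaler_sumr.
rewrite -!big_split /= big_seq [RHS]big_seq.
apply: eq_bigr => k /wu <-.
rewrite ![rmul _ (_ *: _)]linearZ ![lcons _ (_ *: _)]linearZ /=.
rewrite !rmul_M mulM_cons !scalerDr.
move: (lcons (addp x y) _) (lcons y _) (lcons x _) => v3 v2 v1.
by rewrite !scalerA !(mulrC _ u@_k).
Qed.

Lemma msupp_E c k : k \in msupp (E R c) -> weight k = weight c.
Proof.
rewrite -mcoeff_neq0 mcoeff_E; case: ifP => [/refines_weight -> //|].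
by rewrite eqxx.
Qed.

(* With [c] standing for the reversed prefix of a composition and [d] for the
   remaining suffix, [blocks c x d] collects the terms whose first part is the
   sum of a block of parts ending at [x]. *)
Definition blocks c x d : QSym R :=
  \sum_(i < (size c).+1)
     'X^(val (block x (take i c)) * weight (drop i c))
       *: lcons (block x (take i c)) (rmul d (E R (drop i c))).

Lemma rmul_E_nil y d : rmul (y :: d) (E R [::]) = blocks [::] y d.
Proof.
rewrite /blocks big_ord1 /= muln0 expr0 scale1r E_nil !rmul_M !mulM_nil.
by rewrite lcons_M block_nil.
Qed.

Lemma rmul_E_cons_nil x c : rmul [::] (E R (x :: c)) = blocks c x [::].
Proof. by rewrite rmul_nil E_cons; apply: eq_bigr => i _; rewrite rmul_nil. Qed.

(** In the three-term product rule the first part is a block ending at [x], or [y] alone, or such a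
    block merged with [y]. The last two cases are the blocks ending at [y]. *)
Lemma rmul_E_cons x c y d :
  rmul (y :: d) (E R (x :: c)) = blocks c x (y :: d) + blocks (x :: c) y d.
Proof.
rewrite {1}E_cons raddf_sum /=.
under eq_bigr => i _ do
  rewrite [rmul _ (_ *: _)]linearZ /= (rmul_lcons _ _ _ _ _ (msupp_E _))
          !scalerDr.
rewrite !big_split /= -addrA -/(blocks c x (y :: d)); congr (_ + _).
rewrite [RHS]big_ord_recl take0 drop0 block_nil; congr (_ + _).
  rewrite E_cons !(raddf_sum (rmul _)) !(raddf_sum (lcons _)) scaler_sumr.
  apply: eq_bigr => i _ /=.
  rewrite [rmul _ (_ *: _)]linearZ [lcons _ (_ *: _)]linearZ /=.
  (* The exponent is now [val y * weight (x :: c)], independent of [i], so the sum reassembles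
     [E R (x :: c)]. *)
  rewrite val_block_drop; move: (lcons y _) => v.
  by rewrite !scalerA mulrC.
apply: eq_bigr => i _ /=; rewrite addp_block; move: (lcons _ _) => v.
by rewrite scalerA -exprD -mulnDl weight_cons addnC.
Qed.

(** By [rmul_E_cons], consecutive products share a [blocks] term with opposite signs. The
    accumulator [c] is general because the induction moves [x] into it. *)
Lemma alternating_rmul_E x c d :
  \sum_(k < (size d).+1)
     (-1) ^+ k *: rmul (drop k d) (E R (catrev (take k d) (x :: c))) =
  blocks c x d.
Proof.
elim: d x c => [|y d IHd] x c.
  by rewrite big_ord1 expr0 scale1r /= rmul_E_cons_nil.
rewrite big_ord_recl expr0 scale1r /= rmul_E_cons -[RHS]addr0 -addrA.
congr (_ + _); rewrite -(IHd y (x :: c)) -big_split big1 // => k _ /=.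
by rewrite exprS mulN1r scaleNr subrr.
Qed.

Lemma alternating_rmul_E_rev a : a != [::] ->
  \sum_(k < (size a).+1) (-1) ^+ k *: rmul (drop k a) (E R (rev (take k a))) = 0.
Proof.
case: a => // x a _; rewrite big_ord_recl expr0 scale1r /= rmul_E_nil.
(* The product for [k = 0] equals [blocks [::] x a], which the remaining products cancel. *)
rewrite -(alternating_rmul_E x [::] a) -big_split big1 // => k _ /=.
by rewrite exprS mulN1r scaleNr /rev /= subrr.
Qed.

(** * The recursion for the antipode *)

Lemma tensmap_M (f g : QSym R -> QSym R) a b :
  tensmap f g (tens (M R a) (M R b)) = tens (f (M R a)) (g (M R b)).
Proof. by rewrite /tensmap {2}/tens /M !lextU. Qed.

Lemma qmul_tensmap_qcomul (f : QSym R -> QSym R) a :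
  qmul (tensmap f id (qcomul (M R a))) =
  \sum_(k < (size a).+1) rmul (drop k a) (f (M R (take k a))).
Proof.
rewrite /qcomul {1}/M lextU (raddf_sum (tensmap _ _)) (raddf_sum (@qmul R)).
by apply: eq_bigr => k _; rewrite /= tensmap_M qmul_tensM.
Qed.

Lemma antipode_recl (S : {linear QSym R -> QSym R}) a :
    is_antipode S -> a != [::] ->
  \sum_(k < (size a).+1) rmul (drop k a) (S (M R (take k a))) = 0.
Proof.
case=> /(_ (M R a)) + _ a_neq0.
rewrite qmul_tensmap_qcomul => ->.
by rewrite /qcounit /qunit lextU (negPf a_neq0) scale0r.
Qed.

Lemma antipode_nil (S : {linear QSym R -> QSym R}) :
  is_antipode S -> S (M R [::]) = M R [::].
Proof.
case=> /(_ (M R [::])) + _; rewrite qmul_tensmap_qcomul big_ord1 rmul_nil => ->.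
by rewrite /qcounit /qunit lextU scale1r.
Qed.

End QSym.

Theorem proposition3p28 (R : comNzRingType) (S : {linear QSym R -> QSym R})
    (hS : is_antipode S) (n : nat) (a : composition)
    (ha : is_composition_of n a) :
  S (M R a) = (-1) ^+ size a *: E R (rev a).
Proof.
clear n ha; have [m] := ubnP (size a); elim: m a => // m IHm a le_am.
have [->|a_neq0] := eqVneq a [::].
  by rewrite antipode_nil // expr0 scale1r E_nil.
have := etrans (antipode_recl _ _ _ hS a_neq0)
               (esym (alternating_rmul_E_rev _ _ a_neq0)).
(* The two vanishing sums agree by induction on all proper prefixes; the last terms, whose right
   factor is [M R [::]], must then agree too. *)
rewrite !big_ord_recr /= take_size drop_size !rmul_nil.
have lt_take (k : 'I_(size a)) : (size (take k a) < m)%N.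
  by rewrite size_take ltn_ord (leq_trans (ltn_ord k)).
under eq_bigr => k _ do
  rewrite /= (IHm _ (lt_take k)) [rmul _ _ (_ *: _)]linearZ /= size_take ltn_ord.
exact: addrI.
Qed.
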